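(* Let $X=X_\Delta$ be a $3$-dimensional Gorenstein toric cone variety with an isolated singularity, and let $P_\Delta$ be the associated lattice polygon. Suppose that the interior of $P_\Delta$ contains a lattice point, i.e. $X$ is not a terminal singularity. Then there is a basic lattice triangulation of $P_\Delta$ such that the corresponding subdivision $\tilde\Delta$ of $\Delta$ admits a compact strictly upper convex support function $h\in \mathrm{SF}(\tilde\Delta,\mathbb{R})$.
   Context: Let $T=T^n$ be a torus with Lie algebra $\mathfrak{t}\cong\mathbb{R}^n$ and integral lattice $\mathbb{Z}_T\cong\mathbb{Z}^n\subset\mathfrak{t}$ (here $n=3$). A toric cone variety $X_\Delta$ of dimension $n$ is the affine toric variety of a fan $\Delta$ consisting of one $n$-dimensional strongly convex rational polyhedral cone in $\mathfrak{t}$ together with all its faces. Let $u_1,\ldots,u_d\in\mathbb{Z}_T$ be the primitive generators of the rays of this cone. $X_\Delta$ is Gorenstein if there is $\gamma\in\mathbb{Z}_T^*=\mathrm{Hom}(\mathbb{Z}_T,\mathbb{Z})$ with $\langle\gamma,u_i\rangle=-1$ for $i=1,\ldots,d$. Set $H_\gamma=\{x\in\mathfrak{t}:\langle\gamma,x\rangle=-1\}$ and let $P_\Delta$ be the intersection of $H_\gamma$ with the cone; it is an $(n-1)$-dimensional lattice polytope with respect to the lattice $H_\gamma\cap\mathbb{Z}_T\cong\mathbb{Z}^{n-1}$. A triangulation of $P_\Delta$ is a lattice triangulation if the vertices of every simplex are lattice points, and basic if in addition the vertices of every top-dimensional simplex generate a basis of $\mathbb{Z}^{n-1}$ (i.e.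 each such simplex is unimodular). Taking cones over the simplices gives a simplicial subdivision $\tilde\Delta$ of $\Delta$. For a fan $\Delta'$ with convex support $|\Delta'|=\bigcup_{\sigma\in\Delta'}\sigma$, a support function $h\in\mathrm{SF}(\Delta',\mathbb{R})$ is a function $h:|\Delta'|\to\mathbb{R}$ that is linear on each cone: for each $\sigma\in\Delta'$ there is $l_\sigma\in(\mathbb{R}^n)^*$ with $h(x)=\langle l_\sigma,x\rangle$ for $x\in\sigma$ (compatibly on faces). It is (upper) convex if $h(x+y)\geq h(x)+h(y)$ for all $x,y\in|\Delta'|$; then for every $n$-dimensional cone $\sigma$ one has $\langle l_\sigma,x\rangle\geq h(x)$ for all $x\in|\Delta'|$, and $h$ is strictly (upper) convex if for every $n$-dimensional cone $\sigma$ equality holds only for $x\in\sigma$. A strictly convex $h\in\mathrm{SF}(\tilde\Delta,\mathbb{R})$ is compact if $h(u_j)=0$ for $j=1,\ldots,d$, where $u_1,\ldots,u_d$ are the primitive generators of the rays of $\Delta$. *)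

(* Defs.v *)
From mathcomp Require Import all_boot all_order all_algebra.
From mathcomp Require Import finmap complex.
From mathcomp Require Import boolp classical_sets reals topology normedtype.
Set Implicit Arguments.
Unset Strict Implicit.
Unset Printing Implicit Defensive.
Import Order.TTheory GRing.Theory Num.Theory.
Import numFieldNormedType.Exports.
Local Open Scope classical_set_scope.
Local Open Scope ring_scope.

(* The Lie algebra t is 'rV[R]_n, its dual is 'cV[R]_n, and the integral      *)
(* lattices of both are the vectors with integer entries (mxOver Num.int).    *)

Section Cones.
Variables (R : realType) (n : nat).
Local Notation V := 'rV[R]_n.
Local Notation W := 'cV[R]_n.

Definition pairing (m : W) (x : V) : R := (x *m m) 0 0.

Definition is_lattice (v : V) : Prop := v \is a mxOver Num.int.
Definition is_dual_lattice (m : W) : Prop := m \is a mxOver Num.int.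

Definition cone_over (s : {fset V}) : set V :=
  [set x | exists a : V -> R,
     (forall v, 0 <= a v) /\ x = \sum_(v <- s) a v *: v].

Definition rational_polyhedral (sigma : set V) : Prop :=
  exists2 s : {fset V}, (forall v, v \in s -> is_lattice v)
                      & sigma = cone_over s.

Definition strongly_convex (sigma : set V) : Prop :=
  forall x, sigma x -> sigma (- x) -> x = 0.

Definition full_dimensional (A : set V) : Prop :=
  exists M : 'M[R]_n, (forall i, A (row i M)) /\ row_free M.

Definition in_dual_cone (sigma : set V) (m : W) : Prop :=
  forall x, sigma x -> 0 <= pairing m x.

(* The faces of sigma, i.e. the fan Delta of the affine toric variety.        *)
Definition faces (sigma : set V) : set (set V) :=
  [set tau | exists2 m, in_dual_cone sigma m
                      & tau = sigma `&` [set x | pairing m x = 0]].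

Definition is_toric_cone (sigma : set V) : Prop :=
  [/\ rational_polyhedral sigma, strongly_convex sigma
    & full_dimensional sigma].

Definition primitive (u : V) : Prop :=
  [/\ is_lattice u, u != 0 &
   forall (k : nat) (v : V), is_lattice v -> u = k%:R *: v -> k = 1%N].

Definition ray_generator (sigma : set V) (u : V) : Prop :=
  primitive u /\ faces sigma (cone_over [fset u]%fset).

Definition gorenstein_form (sigma : set V) (gamma : W) : Prop :=
  is_dual_lattice gamma /\
  forall u, ray_generator sigma u -> pairing gamma u = -1.

Definition hyperplane (gamma : W) : set V := [set x | pairing gamma x = -1].

Definition polytope (sigma : set V) (gamma : W) : set V :=
  hyperplane gamma `&` sigma.

(* Interior of the polytope relative to the affine hyperplane it spans.       *)
Definition polytope_interior (sigma : set V) (gamma : W) : set V :=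
  [set p | polytope sigma gamma p /\
     \forall q \near p, hyperplane gamma q -> polytope sigma gamma q].

End Cones.

(* The complex points of X = Spec C[S], with S the dual monoid of sigma, are  *)
(* the monoid morphisms from S to multiplicative C.  Morphisms and            *)
(* derivations are extended by 0 to the whole dual space, so that distinct    *)
(* points are distinct functions.                                             *)
Section ToricVariety.
Variables (R : realType) (n : nat).
Local Notation V := 'rV[R]_n.
Local Notation W := 'cV[R]_n.
Local Notation C := (R[i]).
Variable sigma : set V.

Definition dual_monoid : set W :=
  [set m | is_dual_lattice m /\ in_dual_cone sigma m].

Definition toric_variety : set (W -> C) :=
  [set x | [/\ x 0 = 1,
     forall m m', dual_monoid m -> dual_monoid m' -> x (m + m') = x m * x m'
   & forall m, ~ dual_monoid m -> x m = 0]].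

(* The Zariski tangent space at x: C-linear derivations C[S] -> C at x,       *)
(* determined by their values on the characters.                              *)
Definition tangent_space (x : W -> C) : set (W -> C) :=
  [set D | (forall m m', dual_monoid m -> dual_monoid m' ->
              D (m + m') = x m * D m' + D m * x m')
        /\ (forall m, ~ dual_monoid m -> D m = 0)].

Definition has_dimension (E : set (W -> C)) (k : nat) : Prop :=
  exists b : 'I_k -> W -> C,
    (forall c : 'I_k -> C,
       (forall m, \sum_i c i * b i m = 0) -> forall i, c i = 0) /\
    (forall D, E D <->
       exists c : 'I_k -> C, forall m, D m = \sum_i c i * b i m).

Definition singular_point : set (W -> C) :=
  [set x | toric_variety x /\ ~ has_dimension (tangent_space x) n].

Definition regular_function (f : (W -> C) -> C) : Prop :=
  exists (A : {fset W}) (c : W -> C),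
    (forall m, m \in A -> dual_monoid m) /\
    (forall x, f x = \sum_(m <- A) c m * x m).

(* A singular point that is isolated in the singular locus for the Zariski    *)
(* topology, whose basic open sets are the loci f <> 0.                       *)
Definition isolated_singular_point (x : W -> C) : Prop :=
  singular_point x /\
  exists f, [/\ regular_function f, f x <> 0
              & forall y, singular_point y -> f y <> 0 -> y = x].

Definition has_isolated_singularity : Prop :=
  exists x, isolated_singular_point x.

End ToricVariety.

Section Triangulations.
Variables (R : realType) (n : nat).
Local Notation V := 'rV[R]_n.
Local Notation W := 'cV[R]_n.

Definition convex_hull (s : {fset V}) : set V :=
  [set x | exists a : V -> R,
     [/\ forall v, 0 <= a v, \sum_(v <- s) a v = 1
       & x = \sum_(v <- s) a v *: v]].

Definition affinely_independent (s : {fset V}) : Prop :=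
  forall a : V -> R, \sum_(v <- s) a v = 0 -> \sum_(v <- s) a v *: v = 0 ->
    forall v, v \in s -> a v = 0.

(* A simplex is given by its set of vertices; the empty simplex is included,  *)
(* so that the cones over the simplices include the zero cone.                *)
Definition triangulation (P : set V) (T : {fset {fset V}}) : Prop :=
  [/\ forall s, s \in T -> affinely_independent s,
      forall s t : {fset V}, s \in T -> (t `<=` s)%fset -> t \in T,
      forall s t, s \in T -> t \in T ->
        convex_hull s `&` convex_hull t = convex_hull (s `&` t)%fset
    & \bigcup_(s in [set` T]) convex_hull s = P].

Definition lattice_triangulation (P : set V) (T : {fset {fset V}}) : Prop :=
  triangulation P T /\
  forall (s : {fset V}) v, s \in T -> v \in s -> is_lattice v.

Definition is_Zbasis (L : set V) (b : {fset V}) : Prop :=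
  [/\ forall v, v \in b -> L v,
      forall a : V -> int, \sum_(v <- b) v *~ a v = 0 ->
        forall v, v \in b -> a v = 0
    & forall x, L x -> exists a : V -> int, x = \sum_(v <- b) v *~ a v].

(* A top-dimensional simplex in the (n-1)-dimensional hyperplane has n        *)
(* vertices.  Choosing one of them as the origin of the affine lattice        *)
(* identifies the latter with the integral vectors annihilated by gamma.      *)
Definition unimodular (gamma : W) (s : {fset V}) : Prop :=
  forall v0, v0 \in s ->
    is_Zbasis [set x | is_lattice x /\ pairing gamma x = 0]
              [fset v - v0 | v in (s `\ v0)]%fset.

Definition basic_triangulation (gamma : W) (P : set V) (T : {fset {fset V}}) :
    Prop :=
  lattice_triangulation P T /\
  forall s : {fset V}, s \in T -> #|` s| = n -> unimodular gamma s.

Definition cone_fan (T : {fset {fset V}}) : set (set V) :=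
  [set cone_over s | s in [set` T]].

End Triangulations.

Section SupportFunctions.
Variables (R : realType) (n : nat).
Local Notation V := 'rV[R]_n.
Local Notation W := 'cV[R]_n.

Definition support (F : set (set V)) : set V := \bigcup_(tau in F) tau.

Definition represents (l : W) (h : V -> R) (tau : set V) : Prop :=
  forall x, tau x -> h x = pairing l x.

(* The values of h outside the support of F are irrelevant.                   *)
Definition support_function (F : set (set V)) (h : V -> R) : Prop :=
  forall tau, F tau -> exists l, represents l h tau.

Definition upper_convex (F : set (set V)) (h : V -> R) : Prop :=
  forall x y, support F x -> support F y -> h x + h y <= h (x + y).

Definition strictly_upper_convex (F : set (set V)) (h : V -> R) : Prop :=
  upper_convex F h /\
  forall tau l, F tau -> full_dimensional tau -> represents l h tau ->
    forall x, support F x -> pairing l x = h x -> tau x.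

Definition compact_on (sigma : set V) (h : V -> R) : Prop :=
  forall u, ray_generator sigma u -> h u = 0.

End SupportFunctions.

(* Main.v *)
Require Import Defs.
From mathcomp Require Import all_boot all_order all_algebra.
From mathcomp Require Import finmap complex.
From mathcomp Require Import boolp classical_sets cardinality reals topology normedtype.
From mathcomp Require Import ring lra.
Set Implicit Arguments.
Unset Strict Implicit.
Unset Printing Implicit Defensive.
Import Order.TTheory GRing.Theory Num.Theory.
Import numFieldNormedType.Exports.
Local Open Scope classical_set_scope.
Local Open Scope ring_scope.

(** Write P for the polygon and A for its finite set of lattice points.  A
    height function w on A induces the regular subdivision of P: its cells are
    the sets of points of A at which some linear form l with l >= w on A equals
    w, and the upper envelope h = min l over those forms is concave, linear on
    the cone over each cell, and touches l only on the cone over the points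
    where l equals w.  So h is a strictly upper convex support function of any
    triangulation that arises in this way, and it takes the value w(p) at every
    p in A that is a vertex of the subdivision.  It remains to find heights
    such that w vanishes at the ray generators, every point of A is a vertex
    of the subdivision, and all cells are simplices; the triangles are then
    empty lattice triangles, hence unimodular.

    Put w = 0 at the ray generators and, at each other lattice point p, let
    w(p) lie in the interval [C - |p|^2, C - |p|^2 + 1) for a large constant C.
    The tangent plane of the paraboloid C - |x|^2 at p exceeds the paraboloid
    by |q - p|^2 >= 1 at any other lattice point q, so once it is raised to
    height w(p) it lies above w there, whatever the choices within the
    intervals; at the ray generators it lies above 0 because C is large.  A ray
    generator itself is cut out by a large multiple of the form of its face.  Hence every lattice point is a vertex
    ([paraboloid_heights_exposed]).

    The heights within the intervals are chosen one after the other, avoiding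
    each time the finitely many values interpolated from subsets of the earlier
    points ([generic_extension]).  Then a linear dependence inside a cell can
    only involve ray generators.  It would involve three of them, which are
    linearly independent, so the form l of this cell, which vanishes at all
    three, would be zero.  But l >= w > 0 at an interior lattice point
    ([ray_dependence]).

    The existence of a cell whose cone contains a given point of sigma is
    linear programming duality ([optimal_cell]), and both this and the fact
    that sigma is generated by its ray generators ([ray_generators_span]) come
    from Farkas' lemma ([farkas_family]). *)

(** * The pairing and Farkas' lemma *)

Section Pairing.
Variables (R : realType) (n : nat).
Implicit Types (l m : 'cV[R]_n) (x y : 'rV[R]_n) (c : R).

Lemma pairing_sum_entries m x : pairing m x = \sum_i x 0 i * m i 0.
Proof. by rewrite /pairing mxE. Qed.

Lemma pairingDl l m x : pairing (l + m) x = pairing l x + pairing m x.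
Proof. by rewrite /pairing mulmxDr mxE. Qed.

Lemma pairingZl c m x : pairing (c *: m) x = c * pairing m x.
Proof. by rewrite /pairing -scalemxAr mxE. Qed.

Lemma pairingNl m x : pairing (- m) x = - pairing m x.
Proof. by rewrite /pairing mulmxN mxE. Qed.

Lemma pairing0r m : pairing m (0 : 'rV[R]_n) = 0.
Proof. by rewrite /pairing mul0mx mxE. Qed.

Lemma pairingDr m x y : pairing m (x + y) = pairing m x + pairing m y.
Proof. by rewrite /pairing mulmxDl mxE. Qed.

Lemma pairingNr m x : pairing m (- x) = - pairing m x.
Proof. by rewrite /pairing mulNmx mxE. Qed.

Lemma pairingZr c m x : pairing m (c *: x) = c * pairing m x.
Proof. by rewrite /pairing -scalemxAl mxE. Qed.

Lemma pairing_sumr (I : Type) (r : seq I) (P : pred I) m (F : I -> 'rV[R]_n) :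
  pairing m (\sum_(i <- r | P i) F i) = \sum_(i <- r | P i) pairing m (F i).
Proof. by rewrite /pairing mulmx_suml summxE. Qed.

Lemma pairing_suml (I : Type) (r : seq I) (P : pred I) (F : I -> 'cV[R]_n) x :
  pairing (\sum_(i <- r | P i) F i) x = \sum_(i <- r | P i) pairing (F i) x.
Proof. by rewrite /pairing mulmx_sumr summxE. Qed.

Lemma pairing_comb (I : Type) (r : seq I) m (a : I -> R) (f : I -> 'rV[R]_n) :
  pairing m (\sum_(i <- r) a i *: f i) = \sum_(i <- r) a i * pairing m (f i).
Proof. by rewrite pairing_sumr; apply: eq_bigr => i _; rewrite pairingZr. Qed.

Definition sqnorm x : R := pairing x^T x.

Lemma sqnormE x : sqnorm x = \sum_i x 0 i ^+ 2.
Proof. by rewrite /sqnorm pairing_sum_entries; apply: eq_bigr => i _; rewrite mxE. Qed.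

Lemma sqnorm_ge0 x : 0 <= sqnorm x.
Proof. by rewrite sqnormE sumr_ge0 // => i _; rewrite sqr_ge0. Qed.

Lemma sqnorm_gt0 x : x != 0 -> 0 < sqnorm x.
Proof.
move=> /rV0Pn[i xi]; rewrite sqnormE (bigD1 i) //= ltr_wpDr ?exprn_even_gt0 //.
by apply: sumr_ge0 => k _; rewrite sqr_ge0.
Qed.

End Pairing.

Section Farkas.
Variables (R : realType) (n : nat).
Local Notation V := 'rV[R]_n.
Local Notation W := 'cV[R]_n.

(** Bartl's induction on the number of generators.  If a form m certifies that x
    is not in the cone of the generators f i with i in r, then either m also
    certifies this after f j has been added, or f j and x are strictly on the
    same side of the kernel of m.  In that case the problem is projected along
    f j onto that kernel.  A certificate for the projected problem pulls back to
    one that vanishes at f j; a representation of the projection of x lifts to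
    one of x whose coefficient at f j is nonnegative by the signs of m.  The
    generators are a family rather than a set because projecting may identify
    some of them. *)
Lemma farkas_family (I : eqType) (r : seq I) (f : I -> V) (x : V) : uniq r ->
  (exists a : I -> R, (forall i, 0 <= a i) /\ x = \sum_(i <- r) a i *: f i) \/
  (exists m : W, (forall i, i \in r -> 0 <= pairing m (f i)) /\ pairing m x < 0).
Proof.
elim: r f x => [|j r IH] f x /=.
  move=> _; have [->|x0] := eqVneq x 0.
    by left; exists (fun=> 0); rewrite big_nil.
  by right; exists (- x^T); split=> //; rewrite pairingNl oppr_lt0 sqnorm_gt0.
case/andP=> jr ur.
case: (IH f x ur) => [[a [a0 xE]]|[m [m0 mx]]].
  left; exists (fun i => if i == j then 0 else a i); split.
    by move=> i; case: ifP.
  rewrite big_cons eqxx scale0r add0r xE; apply: eq_big_seq => i ir.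
  by case: eqP => // e; rewrite -e ir in jr.
have [mj|mj] := leP 0 (pairing m (f j)).
  by right; exists m; split=> // i; rewrite inE => /predU1P[->|/m0].
(* From here on m is negative at both x and f j; y - k y *: f j is the
   projection of y along f j onto the kernel of m. *)
pose k y := pairing m y / pairing m (f j).
have fj0 : pairing m (f j) != 0 by rewrite lt_eqF.
case: (IH (fun i => f i - k (f i) *: f j) (x - k x *: f j) ur) =>
  [[a [a0 xE]]|[m' [m'0 m'x]]]; last first.
  pose p := m' - (pairing m' (f j) / pairing m (f j)) *: m.
  have pE y : pairing p y = pairing m' (y - k y *: f j).
    rewrite /p pairingDl pairingNl pairingZl pairingDr pairingNr pairingZr /k.
    by field.
  right; exists p; split=> [i|]; last by rewrite pE.
  rewrite inE pE => /predU1P[->|/m'0 //].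
  by rewrite /k divff // scale1r subrr pairing0r.
have kx : 0 <= k x - \sum_(i <- r) a i * k (f i).
  rewrite subr_ge0; apply: (@le_trans _ _ 0).
    rewrite big_seq; apply: sumr_le0 => i ir; rewrite mulr_ge0_le0 //.
    by rewrite mulr_ge0_le0 ?m0 // invr_le0 ltW.
  by rewrite mulr_le0 ?invr_le0 // ltW.
left; exists (fun i => if i == j then k x - \sum_(i <- r) a i * k (f i) else a i).
split=> [i|]; first by case: ifP.
rewrite big_cons eqxx; rewrite [X in _ + X](_ : _ = \sum_(i <- r) a i *: f i); last first.
  by apply: eq_big_seq => i ir; case: eqP => // e; rewrite -e ir in jr.
move/eqP: xE; rewrite subr_eq => /eqP {1}->.
under eq_bigr do rewrite scalerBr scalerA.
by rewrite sumrB -scaler_suml scalerBl [RHS]addrC -addrA [X in _ + X]addrC.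
Qed.

Lemma farkas (s : {fset V}) (x : V) : ~ cone_over s x ->
  exists m, (forall v, v \in s -> 0 <= pairing m v) /\ pairing m x < 0.
Proof.
by move=> sx; case: (@farkas_family _ (enum_fset s) id x (fset_uniq s)).
Qed.

End Farkas.

(** * Finitely generated cones *)

Section ConeOver.
Variables (R : realType) (n : nat).
Local Notation V := 'rV[R]_n.
Local Notation W := 'cV[R]_n.
Implicit Types (s t : {fset V}) (x y : V).

Lemma sum_fset_sub (M : nmodType) s t (F : V -> M) : (s `<=` t)%fset ->
  \sum_(v <- t) (if v \in s then F v else 0) = \sum_(v <- s) F v.
Proof.
move=> st; rewrite -(big_fset_incl _ st) => [|v _ /negPf->] //.
by apply: eq_big_seq => v ->.
Qed.

Lemma comb_sub s t (a : V -> R) : (s `<=` t)%fset ->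
  \sum_(v <- t) (if v \in s then a v else 0) *: v = \sum_(v <- s) a v *: v.
Proof.
move=> st; rewrite -(sum_fset_sub _ st).
by apply: eq_bigr => v _; case: ifP => // _; rewrite scale0r.
Qed.

Lemma cone_over_sub s t : (s `<=` t)%fset -> cone_over s `<=` cone_over t.
Proof.
move=> st _ [a [a0 ->]]; exists (fun v => if v \in s then a v else 0).
by split=> [v|]; [case: ifP | rewrite comb_sub].
Qed.

Lemma cone_over0 s : cone_over s 0.
Proof. by exists (fun=> 0); split=> //; rewrite big1 // => v _; rewrite scale0r. Qed.

Lemma cone_overD s x y : cone_over s x -> cone_over s y -> cone_over s (x + y).
Proof.
move=> [a [a0 ->]] [b [b0 ->]]; exists (a \+ b); split=> [v|]; first exact: addr_ge0.
by rewrite -big_split; apply: eq_bigr => v _; rewrite scalerDl.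
Qed.

Lemma cone_overZ s (c : R) x : 0 <= c -> cone_over s x -> cone_over s (c *: x).
Proof.
move=> c0 [a [a0 ->]]; exists (fun v => c * a v); split=> [v|]; first exact: mulr_ge0.
by rewrite scaler_sumr; apply: eq_bigr => v _; rewrite scalerA.
Qed.

Lemma cone_over_gen s v : v \in s -> cone_over s v.
Proof.
move=> vs; exists (fun u => (u == v)%:R); split=> [u|]; first exact: ler0n.
rewrite (big_fsetD1 v) //= eqxx scale1r big1_seq ?addr0 // => u /andP[_].
by rewrite !inE => /andP[/negPf-> _]; rewrite scale0r.
Qed.

Lemma cone_over_comb (I : eqType) (r : seq I) t (a : I -> R) (f : I -> V) :
  (forall i, i \in r -> 0 <= a i) -> (forall i, i \in r -> cone_over t (f i)) ->
  cone_over t (\sum_(i <- r) a i *: f i).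
Proof.
move=> a0 ft; rewrite big_seq; apply: big_ind => [|x y|i ir].
- exact: cone_over0.
- exact: cone_overD.
by apply: cone_overZ; [exact: a0 | exact: ft].
Qed.

Lemma cone_over_least s t : (forall v, v \in s -> cone_over t v) ->
  cone_over s `<=` cone_over t.
Proof. by move=> h _ [a [a0 ->]]; apply: cone_over_comb. Qed.

Lemma pairing_cone_ge0 (m : W) s x : (forall v, v \in s -> 0 <= pairing m v) ->
  cone_over s x -> 0 <= pairing m x.
Proof.
move=> m0 [a [a0 ->]]; rewrite pairing_comb big_seq.
by apply: sumr_ge0 => v vs; rewrite mulr_ge0 ?m0.
Qed.

Lemma cone_over1 v x : cone_over [fset v]%fset x -> exists2 c : R, 0 <= c & x = c *: v.
Proof. by move=> [a [a0 ->]]; exists (a v) => //; rewrite big_seq_fset1. Qed.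

Lemma convex_hull_cone s x : convex_hull s x -> cone_over s x.
Proof. by move=> [a [a0 _ ->]]; exists a. Qed.

End ConeOver.

Lemma large_multiple (R : realType) (I : eqType) (r : seq I) (f g : I -> R) :
  exists2 c, 0 < c & forall i, i \in r -> 0 < f i -> g i < c * f i.
Proof.
elim: r => [|j r [c c0 IH]]; first by exists 1.
have d0 : 0 <= `|g j| / `|f j| by rewrite divr_ge0.
exists (c + `|g j| / `|f j|) => [|i]; first by rewrite ltr_wpDr.
rewrite inE mulrDl => /predU1P[-> fj0|ir fi0].
  rewrite (gtr0_norm fj0) divfK ?gt_eqF // ltr_pwDl ?ler_norm //.
  exact: mulr_gt0.
by rewrite ltr_wpDr ?IH // mulr_ge0 // ltW.
Qed.

(** * Linear programming duality for heights on a finite point set *)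

Section RegularSubdivision.
Variables (R : realType) (n : nat).
Local Notation V := 'rV[R]_n.
Local Notation W := 'cV[R]_n.
Variables (A : {fset V}) (w : V -> R) (gamma : W).
Hypothesis gammaA : forall v, v \in A -> pairing gamma v = -1.
Implicit Types (l : W) (x : V) (s : {fset V}).

Definition dominates l : Prop := forall v, v \in A -> w v <= pairing l v.

Definition tight l : {fset V} := [fset v in A | pairing l v == w v]%fset.

Lemma tight_sub l : (tight l `<=` A)%fset.
Proof. exact: fset_sub. Qed.

Lemma tightP l v : reflect (v \in A /\ pairing l v = w v) (v \in tight l).
Proof.
by rewrite !inE /=; apply: (iffP andP) => -[vA /eqP] // e; split=> //; apply/eqP.
Qed.

Lemma weak_duality l s x (a : V -> R) : (s `<=` A)%fset -> dominates l ->
  (forall v, 0 <= a v) -> x = \sum_(v <- s) a v *: v ->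
  \sum_(v <- s) a v * w v <= pairing l x.
Proof.
move=> /fsubsetP sA dl a0 ->; rewrite pairing_comb big_seq [leRHS]big_seq.
by apply: ler_sum => v vs; rewrite ler_wpM2l ?dl ?sA.
Qed.

(** Complementary slackness. *)
Lemma duality_eq l s x (a : V -> R) : (s `<=` A)%fset -> dominates l ->
  (forall v, 0 <= a v) -> x = \sum_(v <- s) a v *: v ->
  pairing l x <= \sum_(v <- s) a v * w v ->
  forall v, v \in s -> a v != 0 -> v \in tight l.
Proof.
move=> sA dl a0 xE le v vs av; apply/tightP; have vA := fsubsetP sA v vs.
split=> //; apply/eqP; rewrite eq_le dl // andbT.
rewrite -(@ler_pM2l _ (a v)) ?lt0r ?av ?a0 // -subr_ge0.
move: le; rewrite xE pairing_comb -subr_ge0 -sumrB.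
rewrite (big_fsetD1 v) //=.
move/le_trans; apply; rewrite gerDl big_seq; apply: sumr_le0 => u.
rewrite !inE => /andP[_ us]; rewrite -mulrBr mulr_ge0_le0 // subr_le0.
exact/dl/(fsubsetP sA).
Qed.

Lemma pairing_tight_comb l s x (a : V -> R) : (s `<=` tight l)%fset ->
  x = \sum_(v <- s) a v *: v -> pairing l x = \sum_(v <- s) a v * w v.
Proof.
move=> /fsubsetP sl ->; rewrite pairing_comb; apply: eq_big_seq => v vs.
by have /tightP[_ ->] := sl v vs.
Qed.

Lemma sum_coef x (a : V -> R) s : (s `<=` A)%fset ->
  x = \sum_(v <- s) a v *: v -> \sum_(v <- s) a v = - pairing gamma x.
Proof.
move=> /fsubsetP sA ->; rewrite pairing_comb -sumrN; apply: eq_big_seq => v vs.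
by rewrite gammaA ?sA // mulrN1 opprK.
Qed.

Lemma dominates_exists : exists l, dominates l.
Proof.
have [c c0 ch] := large_multiple (enum_fset A) (fun=> 1) w.
exists (- c *: gamma) => v vA.
by rewrite pairingZl gammaA // mulrNN ltW // ch.
Qed.

(** The bound d on the linear programming problem of minimizing l x over the
    dominating forms is either met or refuted by a combination of the
    constraints.  This is Farkas' lemma one dimension higher, where a form
    (l, t) with t > 0 stands for the solution l / t. *)
Lemma dual_certificate x (d : R) :
  (exists2 l, dominates l & pairing l x <= d) \/
  (exists a b, [/\ forall v, 0 <= a v, 0 <= b,
     \sum_(v <- A) a v *: v = b *: x & b * d < \sum_(v <- A) a v * w v]).
Proof.
pose f (o : option V) : 'rV[R]_(n + 1) :=
  if o is Some v then row_mx v (- w v)%:M else row_mx (- x) d%:M.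
pose r := None :: map Some (enum_fset A).
have ur : uniq r.
  rewrite /= map_inj_uniq ?fset_uniq ?andbT; last by move=> ? ? [].
  by apply/mapP => -[].
have pE (m : 'cV[R]_(n + 1)) y (c : R) :
    pairing m (row_mx y c%:M) = pairing (usubmx m) y + c * m (rshift n 0) 0.
  by rewrite -{1}[m]vsubmxK /pairing mul_row_col mxE mul_scalar_mx !mxE.
have [[a [a0]]|[m [m0]]] := @farkas_family _ _ _ r f (row_mx 0 (-1)%:M) ur.
  rewrite big_cons big_map /= => e; right; exists (a \o Some), (a None).
  split=> // [v||]; first exact: a0.
    have := congr1 lsubmx e; rewrite row_mxKl linearD linear_sum /= !linearZ /=.
    rewrite row_mxKl scalerN => /esym/eqP; rewrite addrC subr_eq0 => /eqP <-.
    by apply: eq_bigr => v _; rewrite linearZ /= row_mxKl.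
  have := congr1 rsubmx e; rewrite row_mxKr linearD linear_sum /= !linearZ /=.
  rewrite row_mxKr => /(congr1 (fun M : 'M_1 => M 0 0)).
  rewrite !mxE eqxx mulr1n => h.
  rewrite -subr_gt0 -[X in _ < X]opprK oppr_gt0 opprB.
  rewrite [X in X < 0](_ : _ = -1) ?oppr_lt0 // h summxE; congr (_ + _).
  rewrite -sumrN; apply: eq_bigr => v _.
  by rewrite [in RHS]linearZ /= row_mxKr !mxE eqxx mulr1n mulrN.
rewrite pE pairing0r add0r mulN1r oppr_lt0; set t := m _ _ => t0.
left; exists (t^-1 *: usubmx m) => [v vA|].
  have := m0 (Some v); rewrite inE mem_map ?vA; last by move=> ? ? [].
  move=> /(_ isT); rewrite pE pairingZl mulNr subr_ge0 -/t => h.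
  by rewrite mulrC ler_pdivlMr.
have := m0 None (mem_head _ _); rewrite pE pairingNr -/t addrC subr_ge0 => h.
by rewrite pairingZl mulrC ler_pdivrMr.
Qed.

(** The infimum of l x over the dominating forms l is attained, since otherwise
    the certificate bounds l x away from it.  At a minimizer, x must lie in the
    cone over the tight points: a form separating x from them would be a
    direction of descent. *)
Lemma optimal_cell x : cone_over A x ->
  exists2 l, dominates l & cone_over (tight l) x.
Proof.
move=> [a [a0 xE]].
pose E := [set pairing l x | l in dominates].
have E0 : E !=set0 by have [l dl] := dominates_exists; exists (pairing l x), l.
have lbE : has_lbound E.
  by exists (\sum_(v <- A) a v * w v) => _ [l dl <-]; apply: weak_duality a0 xE.
have [l dl lx] : exists2 l, dominates l & pairing l x <= inf E.
  have [//|[b [c [b0 c0 bE lt]]]] := dual_certificate x (inf E).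
  have wd l : dominates l -> \sum_(v <- A) b v * w v <= c * pairing l x.
    by move=> dl; rewrite -pairingZr; apply: weak_duality b0 (esym bE).
  have [c_eq0|c_neq0] := eqVneq c 0.
    move: bE lt; rewrite c_eq0 scale0r mul0r => bE.
    have sb := sum_coef (fsubset_refl A) (esym bE).
    rewrite pairing0r oppr0 in sb.
    rewrite big1_seq ?ltxx // => v /andP[_ vA].
    by move/eqP: sb; rewrite psumr_eq0 // => /allP/(_ v vA)/= /eqP ->; rewrite mul0r.
  have cp : 0 < c by rewrite lt0r c_neq0.
  suff : (\sum_(v <- A) b v * w v) / c <= inf E.
    by rewrite leNgt ltr_pdivlMr // mulrC lt.
  apply: lb_le_inf => // _ [l dl <-]; rewrite ler_pdivrMr // mulrC; exact: wd.
exists l => //; apply: contrapT => /farkas[d [d0 dx]].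
(* The slack at the finitely many other points allows for a small step in the
   direction of d. *)
have [c c0 ch] := large_multiple (enum_fset A) (fun v => pairing l v - w v)
  (fun v => - pairing d v).
have : dominates (l + c^-1 *: d).
  move=> v vA; rewrite pairingDl pairingZl.
  have [/eqP lv|lv] := boolP (pairing l v == w v).
    by rewrite lv lerDl mulr_ge0 ?invr_ge0 ?(ltW c0) //; apply/d0/tightP.
  have /(ch v vA) : 0 < pairing l v - w v by rewrite subr_gt0 lt_neqAle eq_sym lv dl.
  rewrite ltrNl -subr_gt0 opprK => h; rewrite -subr_ge0.
  have -> : pairing l v + c^-1 * pairing d v - w v =
      c^-1 * (pairing d v + c * (pairing l v - w v)) by field; rewrite gt_eqF.
  by rewrite mulr_ge0 ?invr_ge0 ?(ltW c0) // ltW.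
move=> dl'; have : inf E <= pairing (l + c^-1 *: d) x.
  by apply: ge_inf => //; exists (l + c^-1 *: d).
rewrite pairingDl pairingZl => /(le_trans lx); rewrite lerDl pmulr_rge0 ?invr_gt0 //.
by rewrite leNgt dx.
Qed.

End RegularSubdivision.

(** * Regular triangulations and their concave envelopes *)

Section RegularTriangulation.
Variables (R : realType) (n : nat).
Local Notation V := 'rV[R]_n.
Local Notation W := 'cV[R]_n.
Variables (A : {fset V}) (w : V -> R) (gamma : W).
Implicit Types (l : W) (x : V) (s t : {fset V}).
Local Notation dominates := (dominates A w).
Local Notation tight := (tight A w).

Definition lin_indep s : Prop :=
  forall a : V -> R, \sum_(v <- s) a v *: v = 0 -> forall v, v \in s -> a v = 0.

Definition generic_heights : Prop := forall l, dominates l -> lin_indep (tight l).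

(** The cells are the tight sets together with their subsets, which makes the
    family closed under passing to faces without any further argument. *)
Definition regular_cells : {fset {fset V}} :=
  [fset s in fpowerset A | `[< exists2 l, dominates l & (s `<=` tight l)%fset >]]%fset.

(** By duality this is, for x in the cone over A, the largest sum of the
    a v * w v over all representations of x as a nonnegative combination of A
    with coefficients a v. *)
Definition envelope x : R := inf [set pairing l x | l in dominates].

Lemma regular_cellsP s :
  s \in regular_cells <-> exists2 l, dominates l & (s `<=` tight l)%fset.
Proof.
rewrite !inE /= fpowersetE; split=> [/andP[_ /asboolP]//|[l dl sl]].
rewrite (fsubset_trans sl (tight_sub _ _ _)) /=; apply/asboolP; by exists l.
Qed.

Lemma cell_sub s : s \in regular_cells -> (s `<=` A)%fset.
Proof. by move/regular_cellsP=> [l _ /fsubset_trans]; apply; apply: tight_sub. Qed.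

Lemma lin_indep_ext s t (c : V -> R) : lin_indep s -> (s `<=` t)%fset ->
  (forall v, v \in t -> c v != 0 -> v \in s) ->
  \sum_(v <- t) c v *: v = 0 -> forall v, v \in t -> c v = 0.
Proof.
move=> si st cs c0 v vt; apply/eqP; apply: contraT => cv.
have vs := cs v vt cv; rewrite (si c _ v vs) ?eqxx // in cv.
apply: etrans c0; apply: big_fset_incl => // u ut us.
have [->|cu] := eqVneq (c u) 0; first by rewrite scale0r.
by rewrite cs in us.
Qed.

Lemma lin_indep_sub s t : (s `<=` t)%fset -> lin_indep t -> lin_indep s.
Proof.
move=> st ti a a0 v vs.
have := ti (fun v => if v \in s then a v else 0).
by rewrite comb_sub // => /(_ a0 v (fsubsetP st v vs)); rewrite vs.
Qed.

Lemma cell_indep s : generic_heights -> s \in regular_cells -> lin_indep s.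
Proof. by move=> gen /regular_cellsP[l dl /lin_indep_sub]; apply; exact: gen. Qed.

(** Two cells meet in a common face.  A point x of the cones over s and t has the
    same height in both, so the points of t that carry x are tight for the form
    of s as well; by linear independence of that tight set the two
    representations of x coincide. *)
Lemma cell_meet s t x (a b : V -> R) : generic_heights ->
  s \in regular_cells -> t \in regular_cells ->
  (forall v, 0 <= a v) -> (forall v, 0 <= b v) ->
  x = \sum_(v <- s) a v *: v -> x = \sum_(v <- t) b v *: v ->
  forall v, v \in s -> a v != 0 -> v \in t.
Proof.
move=> gen sT tT a0 b0 xa xb v vs av.
have [sA tA] := (cell_sub sT, cell_sub tT).
have [l dl sl] := (regular_cellsP s).1 sT.
have [m dm tm] := (regular_cellsP t).1 tT.
have btight : forall u, u \in t -> b u != 0 -> u \in tight l.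
  apply: (duality_eq tA dl b0 xb).
  rewrite -(pairing_tight_comb tm xb).
  apply: (le_trans _ (weak_duality sA dm a0 xa)).
  by rewrite (pairing_tight_comb sl xa).
pose c u := (if u \in s then a u else 0) - (if u \in t then b u else 0).
have cA : forall u, u \in A -> c u = 0.
  apply: (lin_indep_ext (gen l dl) (tight_sub _ _ _)) => [u uA|].
    rewrite /c; case: ifP => [us _|_]; first exact: (fsubsetP sl).
    by case: ifP => [ut|_]; rewrite sub0r oppr_eq0 ?eqxx //; apply: btight.
  rewrite /c; under eq_bigr do rewrite scalerBl.
  by rewrite sumrB !comb_sub // -xa -xb subrr.
have := cA v (fsubsetP sA v vs); rewrite /c vs; case: ifP => // _.
by rewrite subr0 => av0; rewrite av0 eqxx in av.
Qed.

Lemma convex_hull_sub s t : (s `<=` t)%fset -> convex_hull s `<=` convex_hull t.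
Proof.
move=> st x [a [a0 a1 ->]]; exists (fun v => if v \in s then a v else 0).
by split=> [v||]; [case: ifP | rewrite sum_fset_sub | rewrite comb_sub].
Qed.

Lemma cell_hull_meet s t : generic_heights ->
  s \in regular_cells -> t \in regular_cells ->
  convex_hull s `&` convex_hull t = convex_hull (s `&` t)%fset.
Proof.
move=> gen sT tT; apply/seteqP; split=> [x [[a [a0 a1 xa]] [b [b0 b1 xb]]]|x xst].
  have az v : v \in s -> v \notin (s `&` t)%fset -> a v = 0.
    rewrite inE => vs; rewrite vs /=; apply: contraNeq.
    exact: cell_meet gen sT tT a0 b0 xa xb v vs.
  exists a; split=> //; [rewrite -a1 | rewrite xa].
    by apply: big_fset_incl; [exact: fsubsetIl | exact: az].
  apply/esym/big_fset_incl; first exact: fsubsetIl.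
  by move=> v vs /(az v vs) ->; rewrite scale0r.
split; apply: convex_hull_sub xst; [exact: fsubsetIl | exact: fsubsetIr].
Qed.

(** An exposed point is a vertex of the subdivision, and cells meet in common
    faces. *)
Lemma exposed_in_cell p s : generic_heights -> p \in A ->
  (exists2 l, dominates l & pairing l p = w p) ->
  s \in regular_cells -> convex_hull s p -> p \in s.
Proof.
move=> gen pA [l dl lp] sT [a [a0 a1 xE]].
have pT : [fset p]%fset \in regular_cells.
  apply/regular_cellsP; exists l => //; apply/fsubsetP => v; rewrite inE => /eqP ->.
  exact/tightP.
have e : p = \sum_(v <- [fset p]%fset) 1 *: v by rewrite big_seq_fset1 scale1r.
apply: (cell_meet gen pT sT (fun=> ler01) a0 e xE); last exact: oner_neq0.
by rewrite inE.
Qed.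

Hypothesis gammaA : forall v, v \in A -> pairing gamma v = -1.

Lemma hyperplane_cone_hull s x : (s `<=` A)%fset ->
  hyperplane gamma x -> cone_over s x -> convex_hull s x.
Proof.
move=> sA gx [a [a0 xE]]; exists a; split=> //.
by rewrite (sum_coef gammaA sA xE) gx opprK.
Qed.

Lemma convex_hull_hyperplane s x : (s `<=` A)%fset ->
  convex_hull s x -> hyperplane gamma x.
Proof.
move=> sA [a [a0 a1 xE]]; rewrite /hyperplane /=.
by rewrite -[pairing _ _]opprK -(sum_coef gammaA sA xE) a1.
Qed.

Theorem regular_triangulation : generic_heights ->
  triangulation (hyperplane gamma `&` cone_over A) regular_cells.
Proof.
move=> gen; split=> [s sT a _|s t /regular_cellsP[l dl sl] ts||].
- exact: cell_indep sT a.
- by apply/regular_cellsP; exists l => //; apply: fsubset_trans sl.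
- by move=> s t; apply: cell_hull_meet.
apply/seteqP; split=> [x [s /= sT xs]|x [gx xA]].
  split; first exact: convex_hull_hyperplane (cell_sub sT) xs.
  exact: cone_over_sub (cell_sub sT) _ (convex_hull_cone xs).
have [l dl xl] := optimal_cell w gammaA xA.
exists (tight l); first by apply/regular_cellsP; exists l.
exact: hyperplane_cone_hull (tight_sub _ _ _) gx xl.
Qed.

Lemma cone_fan_support : Defs.support (cone_fan regular_cells) = cone_over A.
Proof.
apply/seteqP; split=> [x [_ [s /= sT <-] xs]|x xA].
  exact: cone_over_sub (cell_sub sT) _ xs.
have [l dl xl] := optimal_cell w gammaA xA.
exists (cone_over (tight l)) => //; exists (tight l) => //.
by apply/regular_cellsP; exists l.
Qed.

Lemma envelope_le l x : cone_over A x -> dominates l -> envelope x <= pairing l x.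
Proof.
move=> [a [a0 xE]] dl; apply: ge_inf; last by exists l.
exists (\sum_(v <- A) a v * w v) => _ [m dm <-].
exact: weak_duality (fsubset_refl A) dm a0 xE.
Qed.

Lemma envelope_cell l s x : dominates l -> (s `<=` tight l)%fset ->
  cone_over s x -> envelope x = pairing l x.
Proof.
move=> dl sl xs; have sA := fsubset_trans sl (tight_sub _ _ _).
apply/eqP; rewrite eq_le envelope_le //=; last exact: cone_over_sub sA _ xs.
apply: lb_le_inf; first by exists (pairing l x), l.
move=> _ [m dm <-]; have [a [a0 xE]] := xs.
apply: (le_trans _ (weak_duality sA dm a0 xE)).
by rewrite (pairing_tight_comb sl xE).
Qed.

Lemma envelope_support_function : support_function (cone_fan regular_cells) envelope.
Proof.
move=> _ [s /= /regular_cellsP[l dl sl] <-]; exists l => x xs.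
exact: envelope_cell dl sl xs.
Qed.

Lemma envelope_concave : upper_convex (cone_fan regular_cells) envelope.
Proof.
rewrite /upper_convex cone_fan_support => x y xA yA.
have [l dl xyl] := optimal_cell w gammaA (cone_overD xA yA).
rewrite (envelope_cell dl (fsubset_refl _) xyl) pairingDr.
by apply: lerD; apply: envelope_le.
Qed.

Lemma full_dim_span s (x : V) : full_dimensional (cone_over s) ->
  exists a : V -> R, x = \sum_(v <- s) a v *: v.
Proof.
move=> [M [Ms Mfree]].
have /choice[b bE] i : exists b : V -> R, row i M = \sum_(v <- s) b v *: v.
  by have [b [_ bE]] := Ms i; exists b.
have uM : M \in unitmx by rewrite -row_free_unit.
pose c := x *m invmx M.
exists (fun v => \sum_i c 0 i * b i v).
transitivity (\sum_i c 0 i *: row i M); first by rewrite -mulmx_sum_row mulmxKV.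
under eq_bigr do rewrite bE scaler_sumr.
rewrite exchange_big; apply: eq_bigr => v _ /=.
by rewrite scaler_suml; apply: eq_bigr => i _; rewrite scalerA.
Qed.

(** A tight point outside s would be a combination of the points of s. *)
Lemma full_cell_tight l s : lin_indep (tight l) -> (s `<=` tight l)%fset ->
  full_dimensional (cone_over s) -> s = tight l.
Proof.
move=> li sl fs; apply/eqP; rewrite eqEfsubset sl; apply/fsubsetP => v vl.
apply: contraT => vs; have [a vE] := full_dim_span v fs.
pose c u := (u == v)%:R - (if u \in s then a u else 0).
have : c v = 0.
  apply: (li c) => //; rewrite /c; under eq_bigr do rewrite scalerBl.
  rewrite sumrB comb_sub // -vE (big_fsetD1 v) //= eqxx scale1r.
  rewrite big1_seq ?addr0 ?subrr // => u /andP[_].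
  by rewrite !inE => /andP[/negPf-> _]; rewrite scale0r.
by rewrite /c eqxx (negPf vs) subr0 => /eqP; rewrite oner_eq0.
Qed.

(** Where the form l of a full-dimensional cell agrees with the envelope, the
    points that carry x in its own cell are tight for l by complementary
    slackness, so they belong to the cell of l. *)
Theorem envelope_strictly_convex : generic_heights ->
  strictly_upper_convex (cone_fan regular_cells) envelope.
Proof.
move=> gen; split; first exact: envelope_concave.
rewrite cone_fan_support => _ l' [s /= /regular_cellsP[l dl sl] <-] fs rl x xA lx.
have el : l' = l.
  apply/colP => i; suff h y : pairing l' y = pairing l y.
    have := h (delta_mx 0 i); rewrite !pairing_sum_entries.
    rewrite (bigD1 i) //= big1 => [|j ji]; last by rewrite mxE (negPf ji) andbF mul0r.
    rewrite (bigD1 i) //= big1 => [|j ji]; last by rewrite mxE (negPf ji) andbF mul0r.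
    by rewrite mxE !eqxx !mul1r !addr0.
  have [a ->] := full_dim_span y fs; rewrite !pairing_comb.
  apply: eq_big_seq => v vs; congr (_ * _).
  have vc := cone_over_gen vs.
  by rewrite -(rl v vc) (envelope_cell dl sl vc).
have [m dm xm] := optimal_cell w gammaA xA.
rewrite (full_cell_tight (gen l dl) sl fs).
have [b [b0 xE]] := xm.
have hx : \sum_(v <- tight m) b v * w v = envelope x.
  rewrite (envelope_cell dm (fsubset_refl _) xm).
  by rewrite (pairing_tight_comb (fsubset_refl (tight m)) xE).
have bt := duality_eq (tight_sub _ _ _) dl b0 xE.
rewrite hx -lx el lexx in bt; have {}bt := bt isT.
exists (fun v => if v \in tight m then b v else 0); split=> [v|]; first by case: ifP.
rewrite {1}xE -(comb_sub b (tight_sub A w m)); apply/esym/big_fset_incl.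
  exact: tight_sub.
move=> v vA vl; case: ifP => vm; last by rewrite scale0r.
have [->|bv] := eqVneq (b v) 0; first by rewrite scale0r.
by rewrite bt in vl.
Qed.

End RegularTriangulation.

(** * Empty lattice triangles are unimodular *)

Section Unimodular.
Variable R : realType.

Section Lattice.
Variable n : nat.
Implicit Types x y : 'rV[R]_n.

Lemma latticeD x y : is_lattice x -> is_lattice y -> is_lattice (x + y).
Proof. by move=> /mxOverP hx /mxOverP hy; apply/mxOverP => i j; rewrite mxE rpredD. Qed.

Lemma latticeN x : is_lattice x -> is_lattice (- x).
Proof. by move=> /mxOverP hx; apply/mxOverP => i j; rewrite mxE rpredN. Qed.

Lemma latticeB x y : is_lattice x -> is_lattice y -> is_lattice (x - y).
Proof. by move=> hx hy; apply/latticeD/latticeN. Qed.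

Lemma latticeMz x (k : int) : is_lattice x -> is_lattice (k%:~R *: x).
Proof. by move=> /mxOverP hx; apply/mxOverP => i j; rewrite mxE rpredM // rpred_int. Qed.

Lemma lin_indep_full (s : {fset 'rV[R]_n}) : lin_indep s -> #|` s| = n ->
  full_dimensional (cone_over s).
Proof.
move=> si sn; pose M := \matrix_(i < n) (nth 0 (enum_fset s) i).
exists M; split=> [i|].
  by rewrite rowK; apply: cone_over_gen; rewrite mem_nth // sn.
apply: inj_row_free => u uM; apply/rowP => i; rewrite mxE.
pose a v := if insub (index v (enum_fset s)) is Some j then u 0 j else 0.
have aE (j : 'I_n) : a (nth 0 (enum_fset s) j) = u 0 j.
  by rewrite /a index_uniq ?fset_uniq ?sn // valK.
rewrite -aE; apply: si; last by rewrite mem_nth // sn.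
apply: etrans uM; rewrite mulmx_sum_row (big_nth 0) big_mkord sn.
by apply: eq_bigr => j _; rewrite aE rowK.
Qed.

Lemma sqnorm_lattice_ge1 x : is_lattice x -> x != 0 -> 1 <= sqnorm x.
Proof.
move=> /mxOverP Lx /rV0Pn[i xi].
rewrite sqnormE (bigD1 i) //= -[leLHS]addr0 lerD //.
  by rewrite -real_normK ?num_real // expr_ge1 // norm_intr_ge1.
by apply: sumr_ge0 => j _; rewrite sqr_ge0.
Qed.

End Lattice.

Lemma frac_bounds (x : R) : 0 <= x - (Num.floor x)%:~R < 1.
Proof.
rewrite subr_ge0 floor_le ltrBlDl /=.
by have /andP[_] := floor_itv x; rewrite intrD addrC.
Qed.

(** A lattice vector x of the plane has real coordinates with respect to the two
    edges at v0.  Their fractional parts describe a lattice point of the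
    parallelogram spanned by these edges.  This point or its reflection in the
    centre of the parallelogram lies in the triangle, so it is a vertex, and the
    fractional parts vanish. *)
Lemma empty_triangle_unimodular (gamma : 'cV[R]_3) (s : {fset 'rV[R]_3}) :
  #|` s| = 3%N -> lin_indep s ->
  (forall v, v \in s -> is_lattice v /\ pairing gamma v = -1) ->
  (forall p, is_lattice p -> convex_hull s p -> p \in s) ->
  unimodular gamma s.
Proof.
move=> s3 si sL sE v0 v0s.
have [v1 [v2 [v12 sv]]] : exists v1 v2, v1 != v2 /\ (s `\ v0 = [fset v1; v2])%fset.
  have /eqP := s3; rewrite (cardfsD1 v0) v0s add1n eqSS => /eqP c2.
  have /fset0Pn[v1 v1s] : (s `\ v0 != fset0)%fset by rewrite -cardfs_gt0 c2.
  have /eqP := c2; rewrite (cardfsD1 v1) v1s add1n eqSS => /cardfs1P[v2 e2].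
  have v2s : v2 \in (s `\ v0 `\ v1)%fset by rewrite e2 inE.
  exists v1, v2; split; first by move: v2s; rewrite !inE eq_sym => /andP[].
  by rewrite -(fsetD1K v1s) e2.
have v1s : v1 \in (s `\ v0)%fset by rewrite sv !inE eqxx.
have v2s : v2 \in (s `\ v0)%fset by rewrite sv !inE eqxx orbT.
move: (v1s) (v2s); rewrite !inE => /andP[v10 {}v1s] /andP[v20 {}v2s].
have sumE (M : nmodType) (F : 'rV[R]_3 -> M) :
    \sum_(v <- s) F v = F v0 + (F v1 + F v2).
  by rewrite (big_fsetD1 v0) //= sv big_fsetU1 ?inE //= big_seq_fset1.
have span x : exists c0 c1 c2, x = c0 *: v0 + (c1 *: v1 + c2 *: v2).
  have [a ->] := full_dim_span x (lin_indep_full si s3).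
  by exists (a v0), (a v1), (a v2); rewrite sumE.
pose c3 (c0 c1 c2 : R) v := if v == v0 then c0 else if v == v1 then c1 else c2.
have c3E c0 c1 c2 : [/\ c3 c0 c1 c2 v0 = c0, c3 c0 c1 c2 v1 = c1 & c3 c0 c1 c2 v2 = c2].
  by rewrite /c3 !eqxx (negPf v10) (negPf v20) eq_sym (negPf v12).
have indep c0 c1 c2 : c0 *: v0 + (c1 *: v1 + c2 *: v2) = 0 ->
    [/\ c0 = 0, c1 = 0 & c2 = 0].
  move=> e; have [E0 E1 E2] := c3E c0 c1 c2.
  have := si (c3 c0 c1 c2); rewrite sumE E0 E1 E2 => /(_ e) h.
  by split; [rewrite -E0 | rewrite -E1 | rewrite -E2]; apply: h.
have [[L0 g0] [L1 g1] [L2 g2]] := And3 (sL _ v0s) (sL _ v1s) (sL _ v2s).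
have edge c1 c2 : c1 *: (v1 - v0) + c2 *: (v2 - v0) =
    (- c1 - c2) *: v0 + (c1 *: v1 + c2 *: v2).
  by apply/rowP => i; rewrite !mxE; ring.
have hullP a b : 0 <= a -> 0 <= b -> a + b <= 1 ->
    is_lattice (a *: (v1 - v0) + b *: (v2 - v0)) ->
    [\/ a = 0 /\ b = 0, a = 1 | b = 1].
  move=> a0 b0 ab La; pose p := v0 + (a *: (v1 - v0) + b *: (v2 - v0)).
  have pE : p = (1 - a - b) *: v0 + (a *: v1 + b *: v2).
    by rewrite /p edge; apply/rowP => i; rewrite !mxE; ring.
  have : p \in s.
    apply: sE; first exact: latticeD.
    have [E0 E1 E2] := c3E (1 - a - b) a b.
    exists (c3 (1 - a - b) a b); split.
    - by move=> v; rewrite /c3; do 2?case: ifP => _ //; rewrite -addrA -opprD subr_ge0.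
    - by rewrite sumE E0 E1 E2; ring.
    - by rewrite sumE E0 E1 E2 pE.
  rewrite -(fsetD1K v0s) sv !inE => /or3P[] /eqP pv.
  - have /indep[_ -> ->] : (- a - b) *: v0 + (a *: v1 + b *: v2) = 0.
      by rewrite -edge; apply: (addrI v0); rewrite addr0.
    by constructor 1.
  - have /indep[_ /eqP + _] : (1 - a - b) *: v0 + ((a - 1) *: v1 + b *: v2) = 0.
      by rewrite -[RHS](subrr p) {2}pv pE; apply/rowP => i; rewrite !mxE; ring.
    by rewrite subr_eq0 => /eqP ->; constructor 2.
  have /indep[_ _ /eqP] : (1 - a - b) *: v0 + (a *: v1 + (b - 1) *: v2) = 0.
    by rewrite -[RHS](subrr p) {2}pv pE; apply/rowP => i; rewrite !mxE; ring.
  by rewrite subr_eq0 => /eqP ->; constructor 3.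
have bE : [fset v - v0 | v in (s `\ v0)%fset]%fset = [fset v1 - v0; v2 - v0]%fset.
  by rewrite sv imfsetU1 imfset_fset1.
have d12 : v1 - v0 != v2 - v0 by rewrite (inj_eq (addIr _)).
have sumbE (M : nmodType) (F : 'rV[R]_3 -> M) :
    \sum_(v <- [fset v - v0 | v in (s `\ v0)%fset]%fset) F v =
    F (v1 - v0) + F (v2 - v0).
  by rewrite bE big_fsetU1 ?inE //= big_seq_fset1.
split=> [v|a|x [Lx gx]].
- rewrite bE !inE => /orP[] /eqP ->; split; try exact: latticeB.
    by rewrite pairingDr pairingNr g0 g1 subrr.
  by rewrite pairingDr pairingNr g0 g2 subrr.
- rewrite sumbE -[(v1 - v0) *~ _]scaler_int -[(v2 - v0) *~ _]scaler_int edge.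
  move=> /indep[_ a1 a2] v.
  move/eqP: a1; move/eqP: a2; rewrite !intr_eq0 => /eqP a2 /eqP a1.
  by rewrite bE !inE => /orP[] /eqP ->.
have [c0 [c1 [c2 xE]]] := span x.
have c0E : c0 = - c1 - c2.
  by move: gx; rewrite xE !pairingDr !pairingZr g0 g1 g2; lra.
have {c0 c0E}xE : x = c1 *: (v1 - v0) + c2 *: (v2 - v0) by rewrite edge -c0E.
pose f1 := c1 - (Num.floor c1)%:~R; pose f2 := c2 - (Num.floor c2)%:~R.
have Lf : is_lattice (f1 *: (v1 - v0) + f2 *: (v2 - v0)).
  have -> : f1 *: (v1 - v0) + f2 *: (v2 - v0) = x -
      ((Num.floor c1)%:~R *: (v1 - v0) + (Num.floor c2)%:~R *: (v2 - v0)).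
    by rewrite xE /f1 /f2; apply/rowP => i; rewrite !mxE; ring.
  by apply: latticeB => //; apply: latticeD; apply: latticeMz; apply: latticeB.
have /andP[f1_ge0 f1_lt1] : 0 <= f1 < 1 := frac_bounds c1.
have /andP[f2_ge0 f2_lt1] : 0 <= f2 < 1 := frac_bounds c2.
have [f10 f20] : f1 = 0 /\ f2 = 0.
  have [f12|f12] := leP (f1 + f2) 1.
    case: (hullP f1 f2) => //; lra.
  have Lf' : is_lattice ((1 - f1) *: (v1 - v0) + (1 - f2) *: (v2 - v0)).
    have -> : (1 - f1) *: (v1 - v0) + (1 - f2) *: (v2 - v0) =
        (v1 - v0) + (v2 - v0) - (f1 *: (v1 - v0) + f2 *: (v2 - v0)).
      by apply/rowP => i; rewrite !mxE; ring.
    by apply: latticeB => //; apply: latticeD; apply: latticeB.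
  case: (hullP (1 - f1) (1 - f2)) => //; lra.
exists (fun v => if v == v1 - v0 then Num.floor c1 else Num.floor c2).
rewrite sumbE eqxx eq_sym (negPf d12) xE.
rewrite -[(v1 - v0) *~ _]scaler_int -[(v2 - v0) *~ _]scaler_int.
by congr (_ *: _ + _ *: _); apply/eqP; rewrite -subr_eq0; apply/eqP.
Qed.

End Unimodular.

(** * Generic choice of heights *)

Section GenericHeights.
Variables (R : realType) (n : nat).
Local Notation V := 'rV[R]_n.
Local Notation W := 'cV[R]_n.

Lemma avoid_finite (B : seq R) (a b : R) : a < b ->
  exists t, [/\ a < t, t < b & t \notin B].
Proof.
elim: B a b => [|y B IH] a b ab; first by exists ((a + b) / 2); split=> //; lra.
have [ya|ya] := leP y ((a + b) / 2).
  have /IH[t [t1 t2 tB]] : (a + b) / 2 < b by lra.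
  have yt : y < t by lra.
  by exists t; rewrite inE negb_or tB (gt_eqF yt); split=> //; lra.
have /IH[t [t1 t2 tB]] : a < (a + b) / 2 by lra.
have ty : t < y by lra.
by exists t; rewrite inE negb_or tB (lt_eqF ty); split=> //; lra.
Qed.

(** Here U carries the height 0, and the conclusion says that a linear dependence
    among points on which a form l interpolates the heights involves no point of
    N.  When p is added, its height must differ from every value at p of a form
    that interpolates the earlier heights on a set K of points spanning p.  For
    each K there is at most one such value, so one interpolating form per K
    suffices to describe the values to avoid. *)
Lemma generic_extension (U : {fset V}) (N : seq V) (w0 : V -> R) :
  uniq N -> {in N, forall p, p \notin U} ->
  exists w : V -> R, [/\ {in N, forall p, w0 p <= w p < w0 p + 1},
    forall p, p \notin N -> w p = 0
  & forall (l : W) (c : V -> R),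
      (forall v, v \in N ++ enum_fset U -> c v != 0 -> pairing l v = w v) ->
      \sum_(v <- N ++ enum_fset U) c v *: v = 0 ->
      {in N, forall p, c p = 0}].
Proof.
elim: N => [|p N IH] /=; first by exists (fun=> 0).
case/andP=> pN uN NU.
have [q qN|w [wN wnN wgen]] := IH uN; first by apply: NU; rewrite inE qN orbT.
have pU : p \notin U by apply: NU; rewrite mem_head.
set P := N ++ enum_fset U in wgen *.
have pP : p \notin P by rewrite mem_cat negb_or pN.
pose interp (K : {fset V}) : W := xget 0 [set l | {in K, forall v, pairing l v = w v}].
pose bad := [seq pairing (interp K) p | K <- enum_fset (fpowerset [fset v in P]%fset)].
have [t [t0 t1 tbad]] : exists t, [/\ w0 p < t, t < w0 p + 1 & t \notin bad].
  by apply: avoid_finite; rewrite ltrDl.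
exists (fun v => if v == p then t else w v); split.
- move=> q; rewrite inE; case: eqVneq => [-> _|_ /=]; first by rewrite (ltW t0).
  exact: wN.
- by move=> q; rewrite inE negb_or => /andP[/negPf-> /wnN].
move=> l c cl; rewrite big_cons => csum.
have clP v : v \in P -> c v != 0 -> pairing l v = w v.
  move=> vP cv; rewrite cl ?inE ?vP ?orbT //.
  by case: eqP vP => // ->; rewrite (negPf pP).
have cp : c p = 0.
  apply/eqP; apply: contraNT tbad => cp.
  pose K := [fset v in P | c v != 0]%fset.
  have inK v : v \in K -> v \in P /\ c v != 0 by rewrite !inE => /andP[].
  have interpK : {in K, forall v, pairing (interp K) v = w v}.
    apply: (@xgetPex _ 0 [set l | {in K, forall v, pairing l v = w v}]).
    by exists l => v /inK[]; exact: clP.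
  have val (l' : W) : {in K, forall v, pairing l' v = w v} ->
      pairing l' p = - (\sum_(v <- P) c v * w v) / c p.
    move=> h; apply: (mulfI cp); rewrite [RHS]mulrC divfK //.
    move: csum => /(congr1 (pairing l')); rewrite pairing0r pairingDr pairingZr.
    rewrite pairing_comb => /eqP; rewrite addr_eq0 => /eqP ->; congr (- _).
    apply: eq_big_seq => v vP; have [->|cv] := eqVneq (c v) 0; first by rewrite !mul0r.
    by rewrite h // !inE vP.
  have <- : pairing (interp K) p = t.
    rewrite val // -(@val l); last by move=> v /inK[]; exact: clP.
    by rewrite cl ?mem_head // eqxx.
  apply/mapP; exists K => //; rewrite fpowersetE; apply/fsubsetP => v /inK[vP _].
  by rewrite in_fset.
move=> q; rewrite inE => /predU1P[->//|]; apply: (wgen l c clP _ q).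
by move: csum; rewrite cp scale0r add0r.
Qed.

End GenericHeights.

(** * Ray generators and lattice points of a toric cone *)

Section ToricCones.
Variables (R : realType) (n : nat).
Local Notation V := 'rV[R]_n.
Local Notation W := 'cV[R]_n.

(** Divide by the largest possible integer; a nonzero entry of v bounds it. *)
Lemma primitive_multiple (v : V) : is_lattice v -> v != 0 ->
  exists p (k : nat), [/\ primitive p, (0 < k)%N & v = k%:R *: p].
Proof.
move=> Lv v0; pose Q k := `[< exists2 p, is_lattice p & v = k%:R *: p >].
have [i vi] := rV0Pn _ v0.
have Q1 : exists k, Q k by exists 1%N; apply/asboolP; exists v; rewrite ?scale1r.
have Qb k : Q k -> (k <= Num.bound `|v 0%R i|)%N.
  move=> /asboolP[p /mxOverP Lp vE]; rewrite -(ler_nat R).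
  apply: le_trans (ltW (archi_boundP (normr_ge0 _))) => //.
  move: vi; rewrite vE mxE mulf_eq0 negb_or => /andP[_ pi].
  by rewrite normrM normr_nat ler_peMr // norm_intr_ge1.
case: (ex_maxnP Q1 Qb) => k /asboolP[p Lp vE] kmax.
have k0 : (0 < k)%N.
  by rewrite lt0n; apply: contra_neq v0 => k0; rewrite vE k0 scale0r.
exists p, k; split=> //; split=> //.
  by apply: contra_neq v0 => p0; rewrite vE p0 scaler0.
move=> j q Lq pE; have /kmax : Q (k * j)%N.
  by apply/asboolP; exists q; rewrite // vE pE scalerA natrM.
have : (0 < j)%N.
  rewrite lt0n; apply: contra_neq v0 => j0.
  by rewrite vE pE j0 scale0r scaler0.
by case: j {pE} => [//|[//|j]] _; rewrite leqNgt ltn_Pmulr.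
Qed.

Lemma minimal_generators (s : {fset V}) : exists t : {fset V},
  [/\ (t `<=` s)%fset, cone_over t = cone_over s
    & forall v, v \in t -> ~ cone_over (t `\ v)%fset v].
Proof.
have [k] := ubnP #|` s|; elim: k s => // k IH s sk.
have [[v vs vc]|h] := pselect (exists2 v, v \in s & cone_over (s `\ v)%fset v).
  have [|t [ts te tm]] := IH (s `\ v)%fset.
    by move: sk; rewrite (cardfsD1 v s) vs add1n.
  exists t; split=> //; first exact: fsubset_trans ts (fsubD1set _ _).
  rewrite te; apply/seteqP; split.
    exact/cone_over_sub/fsubD1set.
  apply: cone_over_least => u us; have [->//|uv] := eqVneq u v.
  by apply: cone_over_gen; rewrite !inE uv.
by exists s; split=> // v vs vc; apply: h; exists v.
Qed.

Lemma cone_over_split (s : {fset V}) v x : v \in s -> cone_over s x ->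
  exists c y, [/\ 0 <= c, cone_over (s `\ v)%fset y & x = c *: v + y].
Proof.
move=> vs [a [a0 ->]]; exists (a v), (\sum_(u <- (s `\ v)%fset) a u *: u).
by split=> //; [exists a | rewrite (big_fsetD1 v)].
Qed.

Section Extremal.
Variables (sigma : set V) (s : {fset V}).
Hypothesis sigma_pointed : strongly_convex sigma.
Hypothesis sigmaE : sigma = cone_over s.
Hypothesis s_min : forall v, v \in s -> ~ cone_over (s `\ v)%fset v.

Lemma minimal_gen_neq0 v : v \in s -> v != 0.
Proof.
by move=> vs; apply/eqP => v0; apply: (s_min vs); rewrite {2}v0; exact: cone_over0.
Qed.

(** If no such form existed, Farkas' lemma would put - u in the cone over s and
    - v.  Depending on the sign of the resulting coefficient of v, this makes v a
    combination of the other generators or puts - u in sigma. *)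
Lemma separate_generator v u : v \in s -> u \in (s `\ v)%fset ->
  exists m, [/\ in_dual_cone sigma m, pairing m v = 0 & 0 < pairing m u].
Proof.
move=> vs usv; have us : u \in s by move: usv; rewrite !inE => /andP[].
have gen t : t \in s -> sigma t by rewrite sigmaE; exact: cone_over_gen.
have Nvs : - v \notin s.
  apply: contra (minimal_gen_neq0 vs) => /gen Nv.
  by apply/eqP; apply: sigma_pointed => //; exact: gen.
have : ~ cone_over (- v |` s)%fset (- u).
  move=> /(cone_over_split (fset1U1 _ _))[b [x [b0 xs uE]]].
  move: xs; rewrite fsetU1K // => /(cone_over_split vs)[c [y [c0 ys xE]]].
  have vE : (b - c) *: v = u + y.
    by rewrite -[u]opprK uE xE; apply/rowP => i; rewrite !mxE; ring.
  have [cb|bc] := ltP c b.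
    have bc0 : b - c != 0 by rewrite subr_eq0 gt_eqF.
    apply: (s_min vs); rewrite -[X in cone_over _ X](scalerK bc0) vE.
    apply: cone_overZ; first by rewrite invr_ge0 subr_ge0 ltW.
    by apply: cone_overD => //; exact: cone_over_gen.
  have /eqP := minimal_gen_neq0 us; apply; apply: (sigma_pointed (gen _ us)).
  have -> : - u = (c - b) *: v + y.
    by rewrite -(opprB b c) scaleNr vE; apply/rowP => i; rewrite !mxE; ring.
  rewrite sigmaE; apply: cone_overD; last exact: cone_over_sub (fsubD1set _ _) _ ys.
  by apply: cone_overZ; [rewrite subr_ge0 | exact: cone_over_gen].
move=> /farkas[m [m0]]; rewrite pairingNr oppr_lt0 => mu.
have ms t : t \in s -> 0 <= pairing m t by move=> ts; apply: m0; rewrite !inE ts orbT.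
exists m; split=> //.
  by move=> x; rewrite sigmaE; exact: pairing_cone_ge0.
apply/eqP; rewrite eq_le ms // andbT -oppr_ge0 -pairingNr.
by apply: m0; rewrite !inE eqxx.
Qed.

(** The face is cut out by the sum, over the other generators u, of the forms that
    separate u from v. *)
Lemma extremal_face v : v \in s -> faces sigma (cone_over [fset v]%fset).
Proof.
move=> vs; have h u : exists m, u \in (s `\ v)%fset ->
    [/\ in_dual_cone sigma m, pairing m v = 0 & 0 < pairing m u].
  have [us|us] := boolP (u \in (s `\ v)%fset); last by exists 0.
  by have [m mP] := separate_generator vs us; exists m.
have /choice[m mP] := h.
have dual : in_dual_cone sigma (\sum_(u <- (s `\ v)%fset) m u).
  move=> x xs; rewrite pairing_suml big_seq; apply: sumr_ge0 => u us.
  by have [/(_ x xs)] := mP u us.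
have Mv : pairing (\sum_(u <- (s `\ v)%fset) m u) v = 0.
  by rewrite pairing_suml big_seq big1 // => u us; have [] := mP u us.
exists (\sum_(u <- (s `\ v)%fset) m u) => //.
apply/seteqP; split=> [x /cone_over1[c c0 ->]|x [xs /= Mx]].
  split; last by rewrite /= pairingZr Mv mulr0.
  by rewrite sigmaE; apply/cone_overZ/cone_over_gen.
move: (xs); rewrite sigmaE => -[a [a0 xE]].
exists a; split=> //; rewrite big_seq_fset1 xE (big_fsetD1 v) //=.
rewrite big1_seq ?addr0 // => u /andP[_ us].
have [_ _ mu] := mP u us.
suff /eqP -> : a u == 0 by rewrite scale0r.
have Mgen t : t \in s -> 0 <= pairing (\sum_(u <- (s `\ v)%fset) m u) t.
  by move=> ts; apply: dual; rewrite sigmaE; exact: cone_over_gen.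
have us' : u \in s by move: us; rewrite !inE => /andP[].
move: Mx; rewrite {1}xE pairing_comb big_seq => /eqP.
rewrite psumr_eq0 => [|t ts]; last by rewrite mulr_ge0 ?Mgen.
move=> /allP/(_ u us')/implyP/(_ us'); rewrite mulf_eq0 => /orP[//|].
rewrite pairing_suml (big_fsetD1 u) //= gt_eqF // ltr_wpDr // big_seq.
apply: sumr_ge0 => t; rewrite !inE => /andP[_ ts].
have [d _ _] : [/\ in_dual_cone sigma (m t), pairing (m t) v = 0 & 0 < pairing (m t) t].
  by apply: mP; rewrite !inE.
by apply: d; rewrite sigmaE; exact: cone_over_gen.
Qed.

End Extremal.

Lemma cone_over_scale1 (c : R) (v : V) : 0 < c ->
  cone_over [fset c *: v]%fset = cone_over [fset v]%fset.
Proof.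
move=> c0; apply/seteqP; split=> x /cone_over1[d d0 ->].
  rewrite scalerA; apply: cone_overZ; first by rewrite mulr_ge0 // ltW.
  by apply: cone_over_gen; rewrite inE.
have -> : d *: v = (d / c) *: (c *: v) by rewrite scalerA divfK ?lt0r_neq0.
apply: cone_overZ; first by rewrite divr_ge0 // ltW.
by apply: cone_over_gen; rewrite inE.
Qed.

Lemma ray_generators_span (sigma : set V) :
  rational_polyhedral sigma -> strongly_convex sigma ->
  exists U : {fset V}, (forall u, u \in U -> ray_generator sigma u) /\
    sigma = cone_over U.
Proof.
move=> [s0 s0L sE0] sp; have [s [ss0 sE sm]] := minimal_generators s0.
have {}sE : sigma = cone_over s by rewrite sE.
have h v : exists p, v \in s -> primitive p /\ exists2 c : R, 0 < c & v = c *: p.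
  have [vs|vs] := boolP (v \in s); last by exists 0.
  have [p [k [pp k0 vE]]] := primitive_multiple (s0L v (fsubsetP ss0 v vs))
    (minimal_gen_neq0 sm vs).
  by exists p => _; split=> //; exists k%:R; rewrite ?ltr0n.
have {h}/choice[p pP] := h.
exists [fset p v | v in s]%fset; split=> [u /imfsetP[v /= vs ->]|].
  have [pp [c c0 vE]] := pP v vs; split=> //.
  by rewrite -(cone_over_scale1 _ c0) -vE; exact: (extremal_face sp sE sm vs).
rewrite sE; apply/seteqP; split; apply: cone_over_least => v.
  move=> vs; have [_ [c c0 ->]] := pP v vs.
  by apply: cone_overZ; [exact: ltW | apply/cone_over_gen/imfsetP; exists v].
move=> /imfsetP[u /= us ->]; have [_ [c c0 uE]] := pP u us.
rewrite -[p u](scalerK (lt0r_neq0 c0)) -uE; apply: cone_overZ.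
  by rewrite invr_ge0 ltW.
exact: cone_over_gen.
Qed.

Lemma finite_lattice_ball (N : nat) :
  finite_set [set p : V | is_lattice p /\ forall i, `|p 0 i| <= N%:R].
Proof.
pose f (M : 'rV['I_(N + N).+1]_n) : V := \row_i ((M 0 i)%:R - N%:R).
apply: (@sub_finite_set _ _ (f @` setT)); last exact/finite_image/finite_finset.
move=> p [/mxOverP Lp pN]; pose k i := Num.truncn (p 0 i + N%:R).
have kE i : (k i)%:R = p 0 i + N%:R.
  have := pN i; rewrite ler_norml => /andP[p1 _].
  by rewrite truncnK // natrEint rpredD ?Lp ?rpred_nat //= -lerBlDr sub0r.
exists (\row_i inord (k i)) => //; apply/rowP => i; rewrite !mxE inordK.
  by rewrite kE addrK.
rewrite ltnS -(ler_nat R) kE natrD lerD2r.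
by have := pN i; rewrite ler_norml => /andP[].
Qed.

(** The points of the polytope are convex combinations of U, hence bounded. *)
Lemma lattice_points_finite (U : {fset V}) (gamma : W) :
  (forall u, u \in U -> pairing gamma u = -1) ->
  exists A : {fset V}, forall p,
    p \in A <-> is_lattice p /\ polytope (cone_over U) gamma p.
Proof.
move=> gU.
pose B := \sum_(u <- U) \sum_i `|u 0 i|.
have B0 : 0 <= B by apply: sumr_ge0 => u _; exact: sumr_ge0.
have fin : finite_set [set p | is_lattice p /\ polytope (cone_over U) gamma p].
  apply: sub_finite_set (finite_lattice_ball (Num.bound B)) => p [Lp [gp Up]].
  split=> // i; apply: le_trans (ltW (archi_boundP B0)).
  have [a [a0 a1 ->]] := hyperplane_cone_hull gU (fsubset_refl U) gp Up.
  rewrite summxE; apply: le_trans (ler_norm_sum _ _ _) _.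
  rewrite /B big_seq [leRHS]big_seq; apply: ler_sum => u uU.
  rewrite mxE normrM (ger0_norm (a0 u)).
  apply: (@le_trans _ _ `|u 0 i|); last first.
    by rewrite (bigD1 i) //= lerDl sumr_ge0.
  rewrite ler_piMl // -a1 (big_fsetD1 u) //= lerDl.
  by apply: sumr_ge0.
exists (fset_set [set p | is_lattice p /\ polytope (cone_over U) gamma p]) => p.
by rewrite in_fset_set // inE.
Qed.

End ToricCones.

(** * Forms at ray generators and heights on a paraboloid *)

Section RayGenerators.
Variables (R : realType) (n : nat).
Local Notation V := 'rV[R]_n.
Local Notation W := 'cV[R]_n.
Variables (sigma : set V) (gamma : W).
Hypothesis gamma_ray : forall u, ray_generator sigma u -> pairing gamma u = -1.

Lemma ray_polytope (u : V) : ray_generator sigma u -> polytope sigma gamma u.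
Proof.
move=> ru; split; first exact: gamma_ray.
have [_ [m _ fE]] := ru.
have : cone_over [fset u]%fset u by apply: cone_over_gen; rewrite inE.
by rewrite fE => -[].
Qed.

Lemma ray_form (u : V) : ray_generator sigma u ->
  exists m, [/\ in_dual_cone sigma m, pairing m u = 0
    & forall q, polytope sigma gamma q -> q != u -> 0 < pairing m q].
Proof.
move=> ru; have [_ [m md fE]] := ru; exists m; split=> //.
  have : cone_over [fset u]%fset u by apply: cone_over_gen; rewrite inE.
  by rewrite fE => -[].
move=> q [gq sq] qu; rewrite lt0r md // andbT; apply: contra_neq qu => mq.
have : cone_over [fset u]%fset q by rewrite fE.
move=> /cone_over1[c _ qE]; move: gq; rewrite /hyperplane /= qE pairingZr gamma_ray //.
by move=> /eqP; rewrite mulrN1 eqr_opp => /eqP ->; rewrite scale1r.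
Qed.

(** Applying the form of one generator to the dependence shows that the other
    two coefficients vanish or have opposite signs, and three numbers cannot
    have pairwise opposite signs. *)
Lemma ray_generators_indep (u0 u1 u2 : V) (c0 c1 c2 : R) :
  ray_generator sigma u0 -> ray_generator sigma u1 -> ray_generator sigma u2 ->
  u0 != u1 -> u0 != u2 -> u1 != u2 ->
  c0 *: u0 + c1 *: u1 + c2 *: u2 = 0 -> [/\ c0 = 0, c1 = 0 & c2 = 0].
Proof.
move=> r0 r1 r2 d01 d02 d12 e.
have opp (a b x y : R) : 0 < x -> 0 < y -> a * x + b * y = 0 ->
    a * b <= 0 /\ (a == 0) = (b == 0).
  move=> x0 y0 /eqP; rewrite addr_eq0 => /eqP exy; split.
    rewrite -(pmulr_lle0 _ x0) mulrAC exy mulNr oppr_le0 mulrAC -expr2.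
    by rewrite mulr_ge0 ?sqr_ge0 // ltW.
  have -> : (a == 0) = (a * x == 0) by rewrite mulf_eq0 (gt_eqF x0) orbF.
  by rewrite exy oppr_eq0 mulf_eq0 (gt_eqF y0) orbF.
have val (m : W) : c0 * pairing m u0 + c1 * pairing m u1 + c2 * pairing m u2 = 0.
  by rewrite -!pairingZr -!pairingDr e pairing0r.
have [m0 [_ z0 P0]] := ray_form r0.
have [m1 [_ z1 P1]] := ray_form r1.
have [m2 [_ z2 P2]] := ray_form r2.
have [n12 _] : c1 * c2 <= 0 /\ (c1 == 0) = (c2 == 0).
  apply: (opp _ _ (pairing m0 u1) (pairing m0 u2));
    try by apply: P0; [exact: ray_polytope | rewrite eq_sym].
  by have := val m0; rewrite z0 mulr0 add0r.
have [n02 s02] : c0 * c2 <= 0 /\ (c0 == 0) = (c2 == 0).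
  apply: (opp _ _ (pairing m1 u0) (pairing m1 u2));
    try by apply: P1; [exact: ray_polytope | rewrite // eq_sym].
  by have := val m1; rewrite z1 mulr0 addr0.
have [n01 s01] : c0 * c1 <= 0 /\ (c0 == 0) = (c1 == 0).
  apply: (opp _ _ (pairing m2 u0) (pairing m2 u1));
    try by apply: P2; [exact: ray_polytope |].
  by have := val m2; rewrite z2 mulr0 addr0.
have : (c0 * c1 * c2) ^+ 2 == 0.
  rewrite eq_le sqr_ge0 andbT.
  have -> : (c0 * c1 * c2) ^+ 2 = (c0 * c1) * ((c0 * c2) * (c1 * c2)) by ring.
  by rewrite mulr_le0_ge0 // mulr_le0.
rewrite sqrf_eq0 !mulf_eq0 -s01 -s02 !orbb => c00.
by split; apply/eqP; rewrite -?s01 -?s02.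
Qed.

(** Moving from p slightly away from a point x of sigma off the ray of p leaves
    sigma, because the form of the face of p vanishes at p and is positive at x.
    Full dimension at least two provides such an x. *)
Lemma interior_not_ray (p : V) : (1 < n)%N -> full_dimensional sigma ->
  polytope_interior sigma gamma p -> ~ ray_generator sigma p.
Proof.
move=> n1 [M [Ms Mfree]] [[gp sp] near_p] rp; have [_ [m md fE]] := rp.
have mp : pairing m p = 0.
  have : cone_over [fset p]%fset p by apply: cone_over_gen; rewrite inE.
  by rewrite fE => -[].
have [i mi] : exists i, 0 < pairing m (row i M).
  apply: contrapT => h.
  have /choice[c cE] i : exists c, row i M = c *: p.
    have : cone_over [fset p]%fset (row i M).
      rewrite fE; split=> //=; apply/eqP; rewrite eq_le md // andbT leNgt.
      by apply/negP => mi; apply: h; exists i.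
    by move=> /cone_over1[c _ ->]; exists c.
  have ME : M = (\col_i c i) *m p.
    apply/row_matrixP => i; rewrite cE row_mul.
    by apply/rowP => j; rewrite !mxE big_ord1 !mxE.
  have := mulmx_max_rank (\col_i c i) p; rewrite -ME.
  by rewrite (eqP Mfree) leqNgt n1.
set x := row i M in mi.
(* The direction d leads from p away from x inside the hyperplane. *)
pose d := (- pairing gamma x) *: p - x.
have gd : pairing gamma d = 0.
  by rewrite /d pairingDr pairingNr pairingZr gp; ring.
have mD : pairing m d = - pairing m x.
  by rewrite /d pairingDr pairingNr pairingZr mp; ring.
have /nbhs_ballP[e /= e0 be] := near_p.
pose D := \sum_j `|d 0 j| + 1.
have D0 : 0 < D by rewrite /D ltr_wpDl // sumr_ge0.
have /be : ball p e (p + (e / D) *: d).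
  split=> // a b; rewrite /ball /= !mxE opprD addNKr normrN normrM.
  rewrite gtr0_norm ?divr_gt0 // mulrAC ltr_pdivrMr // ltr_pM2l //.
  rewrite /D (bigD1 b) //= ord1 -addrA [d 0 b]mxE !mxE ltrDl ltr_wpDl //.
  exact: sumr_ge0.
rewrite /hyperplane /= pairingDr pairingZr gd mulr0 addr0 => /(_ gp)[_ /md].
rewrite pairingDr mp add0r pairingZr mD mulrN oppr_ge0 leNgt.
by rewrite mulr_gt0 // divr_gt0.
Qed.

End RayGenerators.

Section Paraboloid.
Variables (R : realType) (n : nat).
Local Notation V := 'rV[R]_n.
Local Notation W := 'cV[R]_n.

(** On the hyperplane gamma = -1, the affine function whose graph is the tangent
    plane at p of the graph of C - |x|^2. *)
Definition tangent_form (gamma : W) (C : R) (p : V) : W :=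
  - ((C + sqnorm p) *: gamma + 2 *: p^T).

Lemma tangent_formE (gamma : W) (C : R) (p q : V) : pairing gamma q = -1 ->
  pairing (tangent_form gamma C p) q = C - sqnorm q + sqnorm (q - p).
Proof.
move=> gq; rewrite pairingNl pairingDl !pairingZl gq.
have -> : sqnorm (q - p) = sqnorm q - 2 * pairing p^T q + sqnorm p.
  rewrite !sqnormE pairing_sum_entries mulr_sumr -sumrB -big_split /=.
  by apply: eq_bigr => i _; rewrite !mxE; ring.
by ring.
Qed.

(** Raising the tangent plane at p to height w p keeps it above w at all other
    points of A that are not ray generators, as it exceeds C - |v|^2 by at least
    1 there, and above the value 0 at the ray generators, as C exceeds |v|^2.
    At a ray generator a large multiple of the form of its face serves. *)
Lemma paraboloid_heights_exposed (sigma : set V) (gamma : W) (A : {fset V})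
    (C : R) (w : V -> R) :
  (forall u, ray_generator sigma u -> pairing gamma u = -1) ->
  (forall v, v \in A -> is_lattice v /\ polytope sigma gamma v) ->
  (forall v, v \in A -> 0 < C - sqnorm v) ->
  (forall u, ray_generator sigma u -> w u = 0) ->
  (forall v, v \in A -> ~ ray_generator sigma v ->
     C - sqnorm v <= w v < C - sqnorm v + 1) ->
  forall p, p \in A -> exists2 l, dominates A w l & pairing l p = w p.
Proof.
move=> gray AP CA w_ray wN p pA.
have gA v : v \in A -> pairing gamma v = -1 by case/AP=> _ [].
have [rp|rp] := pselect (ray_generator sigma p).
  have [m [md mp mpos]] := ray_form gray rp.
  have [c c0 cP] := large_multiple (enum_fset A) (pairing m) w.
  exists (c *: m); last by rewrite pairingZl mp mulr0 w_ray.
  move=> v vA; rewrite pairingZl; have [->|vp] := eqVneq v p.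
    by rewrite mp mulr0 w_ray.
  by apply/ltW/cP => //; apply: mpos => //; have [] := AP v vA.
have /andP[w1 w2] := wN p pA rp.
exists (tangent_form gamma C p - (w p - (C - sqnorm p)) *: gamma) => [v vA|];
  rewrite pairingDl tangent_formE ?gA // pairingNl pairingZl gA //; last first.
  by rewrite subrr /sqnorm pairing0r; ring.
have [->|vp] := eqVneq v p; first by rewrite subrr /sqnorm pairing0r; lra.
have [rv|rv] := pselect (ray_generator sigma v).
  rewrite w_ray //; have := CA v vA; have := sqnorm_ge0 (v - p); lra.
have /andP[_] := wN v vA rv.
have : 1 <= sqnorm (v - p).
  apply: sqnorm_lattice_ge1; last by rewrite subr_eq0.
  by apply: latticeB; [have [] := AP v vA | have [] := AP p pA].
lra.
Qed.

End Paraboloid.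

(** * The triangulation of the polygon *)

Section RayDependence.
Variables (R : realType) (sigma : set 'rV[R]_3) (gamma : 'cV[R]_3).
Hypothesis gamma_ray : forall u, ray_generator sigma u -> pairing gamma u = -1.

Lemma vanish_on_three_rays (l : 'cV[R]_3) (u0 u1 u2 x : 'rV[R]_3) :
  (forall u, u \in [:: u0; u1; u2] -> ray_generator sigma u /\ pairing l u = 0) ->
  u0 != u1 -> u0 != u2 -> u1 != u2 -> pairing l x = 0.
Proof.
move=> ru d01 d02 d12.
have [[r0 _] [r1 _] [r2 _]] : [/\ ray_generator sigma u0 /\ pairing l u0 = 0,
    ray_generator sigma u1 /\ pairing l u1 = 0
    & ray_generator sigma u2 /\ pairing l u2 = 0].
  by split; apply: ru; rewrite !inE eqxx ?orbT.
pose s := [fset u0; u1; u2]%fset.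
have sumE (M : nmodType) (F : 'rV[R]_3 -> M) : \sum_(v <- s) F v = F u0 + F u1 + F u2.
  rewrite /s -fsetUA big_fsetU1 ?inE ?negb_or ?d01 //= big_fsetU1 ?inE //=.
  by rewrite big_seq_fset1 addrA.
have s3 : #|` s| = 3%N.
  by rewrite /s -fsetUA cardfsU1 cardfs2 d12 !inE negb_or d01 d02.
have smem u : u \in s -> u \in [:: u0; u1; u2] by rewrite !inE orbA.
have si : lin_indep s.
  move=> a; rewrite sumE.
  move=> /(ray_generators_indep gamma_ray r0 r1 r2 d01 d02 d12)[a0 a1 a2] v.
  by rewrite !inE -orbA => /or3P[] /eqP ->.
have [a ->] := full_dim_span x (lin_indep_full si s3).
rewrite pairing_comb big1_seq // => v /andP[_ /smem/ru[_ ->]].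
by rewrite mulr0.
Qed.

Variables (A : {fset 'rV[R]_3}) (w : 'rV[R]_3 -> R) (p0 : 'rV[R]_3).
Hypothesis gammaA : forall v, v \in A -> pairing gamma v = -1.
Hypothesis w_ray : forall u, ray_generator sigma u -> w u = 0.
Hypothesis p0A : p0 \in A.
Hypothesis w_p0 : 0 < w p0.

(** A nontrivial dependence among ray generators of a cell involves at least three
    of them, since its coefficients sum to 0.  The form of the cell vanishes at
    these, hence everywhere, although it is positive at p0. *)
Lemma ray_dependence (l : 'cV[R]_3) (c : 'rV[R]_3 -> R) : dominates A w l ->
  (forall v, v \in A -> c v != 0 -> ray_generator sigma v /\ v \in tight A w l) ->
  \sum_(v <- A) c v *: v = 0 -> forall v, v \in A -> c v = 0.
Proof.
move=> dl cl csum u0 u0A; apply/eqP; apply: contraT => cu0.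
have csum1 : \sum_(v <- A) c v = 0.
  move: (congr1 (pairing gamma) csum); rewrite pairing_comb pairing0r.
  rewrite (eq_big_seq (fun v => - c v)) => [/eqP|v vA].
    by rewrite sumrN oppr_eq0 => /eqP.
  by rewrite gammaA // mulrN1.
have cray v : v \in A -> c v != 0 -> ray_generator sigma v /\ pairing l v = 0.
  by move=> vA cv; have [rv /tightP[_ ->]] := cl v vA cv; rewrite w_ray.
have [u1 [u1A u01 cu1]] : exists u1, [/\ u1 \in A, u0 != u1 & c u1 != 0].
  apply: contrapT => h; move: csum1; rewrite (big_fsetD1 u0) //= big1_seq.
    by rewrite addr0 => /eqP; apply/negP.
  move=> v /andP[_]; rewrite !inE => /andP[vu vA]; apply/eqP; apply: contraT => cv.
  by case: h; exists v; rewrite eq_sym.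
have u1A0 : u1 \in (A `\ u0)%fset by rewrite !inE eq_sym u01.
have [u2 [u2A u02 u12 cu2]] : exists u2, [/\ u2 \in A, u0 != u2, u1 != u2 & c u2 != 0].
  apply: contrapT => h.
  have z v : v \in (A `\ u0 `\ u1)%fset -> c v = 0.
    rewrite !inE => /and3P[v1 v0 vA]; apply/eqP; apply: contraT => cv.
    by case: h; exists v; rewrite (eq_sym u0) v0 (eq_sym u1) v1.
  have split2 (M : nmodType) (F : 'rV[R]_3 -> M) :
      \sum_(v <- A) F v = F u0 + (F u1 + \sum_(v <- (A `\ u0 `\ u1)%fset) F v).
    by rewrite (big_fsetD1 u0) //= (big_fsetD1 u1).
  move: csum csum1; rewrite !split2 big1_seq; last first.
    by move=> v /andP[_ /z ->]; rewrite scale0r.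
  rewrite big1_seq; last by move=> v /andP[_ /z].
  rewrite !addr0 => e /eqP; rewrite addr_eq0 => /eqP e0.
  move: e; rewrite e0 scaleNr addrC -scalerBr => /eqP.
  by rewrite scaler_eq0 (negPf cu1) subr_eq0 eq_sym (negPf u01).
have := dl p0 p0A; rewrite (@vanish_on_three_rays l u0 u1 u2 p0) ?leNgt ?w_p0 //.
by move=> u; rewrite !inE => /or3P[] /eqP ->; apply: cray.
Qed.

End RayDependence.

Theorem proposition3p13 (R : realType) (sigma : set 'rV[R]_3)
  (gamma : 'cV[R]_3)
  (sigma_cone : is_toric_cone sigma)
  (sigma_gorenstein : gorenstein_form sigma gamma)
  (sigma_isolated : has_isolated_singularity sigma)
  (interior_point : exists p : 'rV[R]_3,
     is_lattice p /\ polytope_interior sigma gamma p) :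
  exists T : {fset {fset 'rV[R]_3}},
    basic_triangulation gamma (polytope sigma gamma) T /\
    exists h : 'rV[R]_3 -> R,
      [/\ support_function (cone_fan T) h,
          strictly_upper_convex (cone_fan T) h
        & compact_on sigma h].
Proof.
have [rat pointed full] := sigma_cone.
have [_ gray] := sigma_gorenstein.
have [U [Uray UE]] := ray_generators_span rat pointed.
have gU u : u \in U -> pairing gamma u = -1 by move/Uray/gray.
have [A AP] := lattice_points_finite gU; rewrite -UE in AP.
have rayA u : ray_generator sigma u -> u \in A.
  move=> ru; apply/AP; split; first by have [[]] := ru.
  exact: ray_polytope gray u ru.
have gA v : v \in A -> pairing gamma v = -1 by move=> /AP[_ []].
have AE : sigma = cone_over A.
  apply/seteqP; split.
    by rewrite UE; apply: cone_over_least => u /Uray/rayA; exact: cone_over_gen.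
  by rewrite [X in _ `<=` X]UE; apply: cone_over_least => v /AP[_ [_]]; rewrite UE.
pose C := \sum_(v <- A) sqnorm v + 1.
have CA v : v \in A -> 0 < C - sqnorm v.
  move=> vA; rewrite /C (big_fsetD1 v) //=.
  have : 0 <= \sum_(u <- (A `\ v)%fset) sqnorm u.
    by apply: sumr_ge0 => u _; exact: sqnorm_ge0.
  lra.
pose isray v := `[< ray_generator sigma v >].
pose N := [seq v <- enum_fset A | ~~ isray v].
pose V := [fset v in A | isray v]%fset.
have NP v : v \in N <-> v \in A /\ ~ ray_generator sigma v.
  by rewrite mem_filter; split=> [/andP[/asboolPn]//|[-> /asboolPn ->]].
have [||w [wN wnN wgen]] := @generic_extension R 3 V N (fun v => C - sqnorm v).
- exact/filter_uniq/fset_uniq.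
- by move=> v; rewrite mem_filter !inE => /andP[/negPf-> _]; rewrite andbF.
have w_ray u : ray_generator sigma u -> w u = 0.
  by move=> ru; apply: wnN; apply/negP => /NP[_].
have [p0 [Lp0 ip0]] := interior_point.
have p0A : p0 \in A by apply/AP; split=> //; case: ip0.
have p0N : p0 \in N by apply/NP; split=> //; exact: interior_not_ray full ip0.
have w_p0 : 0 < w p0.
  by have /andP[+ _] := wN _ p0N; apply: lt_le_trans; exact: CA.
have permA : perm_eq (N ++ enum_fset V) (enum_fset A).
  apply: uniq_perm; [|exact: fset_uniq|].
    rewrite cat_uniq filter_uniq ?fset_uniq // andbT; apply/hasPn => v /=.
    by rewrite !inE mem_filter => /andP[_ ->].
  move=> v; rewrite mem_cat mem_filter !inE.
  by case: (isray v); rewrite ?andbT ?andbF ?orbF.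
have gen : generic_heights A w.
  move=> l dl c csum.
  pose c' v := if v \in tight A w l then c v else 0.
  have c't v : c' v != 0 -> v \in tight A w l by rewrite /c'; case: ifP; rewrite ?eqxx.
  have c'sum : \sum_(v <- A) c' v *: v = 0 by rewrite comb_sub ?tight_sub.
  have c'N : {in N, forall v, c' v = 0}.
    apply: (wgen l); last by rewrite (perm_big _ permA).
    by move=> v _ /c't/tightP[].
  have c'0 : forall v, v \in A -> c' v = 0.
    apply: (ray_dependence gray gA w_ray p0A w_p0 dl _ c'sum) => v vA cv.
    split; last exact: c't.
    by apply: contrapT => rv; move: cv; rewrite c'N ?eqxx //; apply/NP.
  move=> v vt; rewrite -[LHS](_ : c' v = c v); last by rewrite /c' vt.
  by apply: c'0; apply: fsubsetP vt; exact: tight_sub.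
have exposed p : p \in A -> exists2 l, dominates A w l & pairing l p = w p.
  apply: (paraboloid_heights_exposed gray _ CA w_ray) => [v /AP //|v vA rv].
  by apply: wN; apply/NP.
exists (regular_cells A w); split.
  split; first split.
  - by rewrite /polytope AE; exact: regular_triangulation.
  - by move=> s v /cell_sub/fsubsetP sA /sA/AP[].
  move=> s sT s3; have sA := cell_sub sT.
  apply: empty_triangle_unimodular => //; first exact: cell_indep gen sT.
    by move=> v /(fsubsetP sA) vA; split; [have [] := (AP v).1 vA | exact: gA].
  move=> p Lp ps; have pA : p \in A.
    apply/AP; split=> //; split; first exact: (convex_hull_hyperplane gA sA ps).
    by rewrite AE; exact: (cone_over_sub sA (convex_hull_cone ps)).
  exact: (exposed_in_cell gen pA (exposed p pA) sT ps).
exists (envelope A w); split.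
- exact: envelope_support_function.
- exact: (envelope_strictly_convex gA gen).
move=> u ru; have uA := rayA u ru; have [l dl lu] := exposed u uA.
rewrite (@envelope_cell _ _ A w l [fset u]%fset) //.
- by rewrite lu w_ray.
- by apply/fsubsetP => v; rewrite inE => /eqP ->; apply/tightP.
by apply: cone_over_gen; rewrite inE.
Qed.
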